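(* Let $I\unlhd K[x_1,\dots,x_n]$ be an ideal. The projection $\mathbb R_{\le0}\times\mathbb R^n\to\mathbb R^n$ induces a bijection $$\operatorname{Trop}(\pi^{-1}I)\cap(\{-1\}\times\mathbb R^n)\longrightarrow\operatorname{Trop}_\nu(I),\qquad(-1,w_1,\dots,w_n)\mapsto(w_1,\dots,w_n).$$
   Context: Let $K$ be a complete field with a non-trivial discrete valuation $\nu:K\to\mathbb R\cup\{\infty\}$ and a uniformizing parameter $p\in K$, with $\nu$ normalized so that $\nu(p)=1$. Let $\mathcal O_K$ be its ring of integers and $\mathfrak K$ its residue field. Let $R\subseteq\mathcal O_K$ be a dense noetherian subring with $p\in R$. The map $\pi:R[[t]][x]\to\mathcal O_K[x]\subseteq K[x]$, $t\mapsto p$, has $\ker(R[[t]][x]\to\mathcal O_K[x])=\langle p-t\rangle$. $\pi^{-1}I$ denotes the preimage of $I$ in $R[[t]][x]$. For $f=\sum_\alpha c_\alpha x^\alpha\in K[x]$ and $w\in\mathbb R^n$, $\operatorname{in}_{\nu,w}(f)=\sum \overline{c_\alpha p^{-\nu(c_\alpha)}}x^\alpha\in\mathfrak K[x]$. The sum runs over the $\alpha$ with $c_\alpha\ne0$ for which $w\cdot\alpha-\nu(c_\alpha)$ is maximal. $\operatorname{in}_{\nu,w}(I)$ is the ideal generated by the $\operatorname{in}_{\nu,w}(f)$ with $f\in I$. We set $\operatorname{Trop}_\nu(I)=\{w\in\mathbb R^n:\operatorname{in}_{\nu,w}(I)\text{ contains no monomial}\}$. For $f=\sum c_{\alpha,\beta}t^\beta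 x^\alpha\in R[[t]][x]$ and $w\in\mathbb R_{<0}\times\mathbb R^n$, $\operatorname{in}_w(f)\in R[t,x]$ is the sum of the terms with $w\cdot(\beta,\alpha)$ maximal. $\operatorname{in}_w(J)$ is the ideal of $R[t,x]$ generated by the $\operatorname{in}_w(f)$ with $f\in J$. For $J\unlhd R[[t]][x]$, $\operatorname{Trop}(J)\subseteq\mathbb R_{\le0}\times\mathbb R^n$ is the Euclidean closure of the set of $w\in\mathbb R_{<0}\times\mathbb R^n$ such that $\operatorname{in}_w(J)$ contains no monomial $t^\beta x^\alpha$. *)

(* Defs.v *)
From HB Require Import structures.
From mathcomp Require Import all_boot all_order all_algebra.
From mathcomp Require Import mpoly.
From mathcomp Require Import reals.
Set Implicit Arguments. Unset Strict Implicit. Unset Printing Implicit Defensive.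
Import Order.TTheory GRing.Theory Num.Theory.
Local Open Scope ring_scope.

Definition is_ideal (A : comNzRingType) (S : A -> Prop) : Prop :=
  [/\ S 0, (forall x y, S x -> S y -> S (x + y))
    & (forall a x, S x -> S (a * x))].

Definition in_gen_ideal (A : comNzRingType) (S : A -> Prop) (x : A) : Prop :=
  exists (k : nat) (g s : 'I_k -> A),
    (forall i, S (s i)) /\ x = \sum_(i < k) g i * s i.

Definition noetherian (A : comNzRingType) : Prop :=
  forall S : A -> Prop, is_ideal S ->
    exists (k : nat) (g : 'I_k -> A),
      forall x, S x <-> in_gen_ideal (fun y => exists i, y = g i) x.

(* nu : K -> int is the normalised discrete valuation on K^x (nu 0 = oo is
   handled by always treating 0 separately). *)

Definition is_valuation (K : fieldType) (nu : K -> int) : Prop :=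
  (forall x y, x != 0 -> y != 0 -> nu (x * y) = nu x + nu y) /\
  (forall x y, x != 0 -> y != 0 -> x + y != 0 ->
     Order.min (nu x) (nu y) <= nu (x + y)).

Definition inO (K : fieldType) (nu : K -> int) (x : K) : Prop :=
  x = 0 \/ 0 <= nu x.

Definition closeN (K : fieldType) (nu : K -> int) (N : nat) (x y : K) : Prop :=
  x = y \/ (N%:Z <= nu (x - y)).

Definition converges (K : fieldType) (nu : K -> int) (s : nat -> K) (L : K) :=
  forall N : nat, exists M : nat, forall m, (M <= m)%N -> closeN nu N (s m) L.

Definition cauchy (K : fieldType) (nu : K -> int) (s : nat -> K) :=
  forall N : nat, exists M : nat, forall m k, (M <= m)%N -> (M <= k)%N ->
    closeN nu N (s m) (s k).

Definition complete (K : fieldType) (nu : K -> int) : Prop :=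
  forall s : nat -> K, cauchy nu s -> exists L, converges nu s L.

Definition residue_map (K : fieldType) (nu : K -> int) (kk : fieldType)
  (res : K -> kk) : Prop :=
  [/\ res 1 = 1,
      (forall x y, inO nu x -> inO nu y -> res (x + y) = res x + res y),
      (forall x y, inO nu x -> inO nu y -> res (x * y) = res x * res y),
      (forall x, inO nu x -> (res x = 0 <-> (x = 0 \/ 0 < nu x)))
    & (forall c : kk, exists x, inO nu x /\ res x = c)].

Definition dense_in_O (K : fieldType) (nu : K -> int) (R : comNzRingType)
  (iota : R -> K) : Prop :=
  forall a, inO nu a -> forall N : nat, exists r, closeN nu N a (iota r).

Definition wdot (Rr : realType) (n : nat) (w : 'I_n -> Rr) (m : 'X_{1..n}) : Rr :=
  \sum_(i < n) w i * (m i)%:R.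

Section InitNu.
Variables (Rr : realType) (K : fieldType) (nu : K -> int) (kk : fieldType)
  (res : K -> kk) (p : K) (n : nat).

Definition valw (w : 'I_n -> Rr) (f : {mpoly K[n]}) (m : 'X_{1..n}) : Rr :=
  wdot w m - (nu f@_m)%:~R.

Definition in_nu (w : 'I_n -> Rr) (f : {mpoly K[n]}) : {mpoly kk[n]} :=
  \sum_(m <- msupp f | all (fun m' => valw w f m' <= valw w f m) (msupp f))
     res (f@_m * p ^ (- nu f@_m)) *: 'X_[m].

Definition Trop_nu (I : {mpoly K[n]} -> Prop) (w : 'I_n -> Rr) : Prop :=
  forall m : 'X_{1..n},
    ~ in_gen_ideal (fun g => exists f, I f /\ g = in_nu w f) 'X_[m].
End InitNu.

(* An element of R[[t]][x] is represented by its sequence of t-coefficients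
   F : nat -> {mpoly R[n]} (F b = coefficient of t^b), with uniformly bounded
   support in x (i.e. it is a polynomial in x over R[[t]]).
   The coefficient c_{alpha,beta} is (F beta)@_alpha. *)

Section PowerSeries.
Variables (Rr : realType) (K : fieldType) (nu : K -> int) (R : comNzRingType)
  (iota : {rmorphism R -> K}) (p : R) (n : nat).

Definition psx_bounded (F : nat -> {mpoly R[n]}) : Prop :=
  exists d : nat, forall b, (msize (F b) <= d)%N.

(* pi(F) = g, where t |-> p : the coefficient of x^alpha in g is the limit of
   sum_{b < N} iota(c_{alpha,b}) p^b *)
Definition pi_rel (F : nat -> {mpoly R[n]}) (g : {mpoly K[n]}) : Prop :=
  forall a : 'X_{1..n},
    converges nu (fun N => \sum_(b < N) iota (F b)@_a * iota p ^+ b) g@_a.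

Definition preimage (I : {mpoly K[n]} -> Prop) (F : nat -> {mpoly R[n]}) : Prop :=
  psx_bounded F /\ exists g, pi_rel F g /\ I g.

(* splitting a monomial in (t, x_1..x_n): variable 0 is t *)
Definition mtail (m : 'X_{1..n.+1}) : 'X_{1..n} :=
  [multinom m (lift ord0 i) | i < n].

Definition coef_tx (F : nat -> {mpoly R[n]}) (m : 'X_{1..n.+1}) : R :=
  (F (m ord0))@_(mtail m).

Definition is_max_term (v : 'I_n.+1 -> Rr) (F : nat -> {mpoly R[n]})
  (m : 'X_{1..n.+1}) : Prop :=
  coef_tx F m != 0 /\
  forall m', coef_tx F m' != 0 -> wdot v m' <= wdot v m.

(* g = in_v(F) in R[t,x] = {mpoly R[n.+1]} (variable 0 is t) *)
Definition init_rel (v : 'I_n.+1 -> Rr) (F : nat -> {mpoly R[n]})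
  (g : {mpoly R[n.+1]}) : Prop :=
  forall m, (is_max_term v F m -> g@_m = coef_tx F m) /\
            (~ is_max_term v F m -> g@_m = 0).

Definition Trop_open (J : (nat -> {mpoly R[n]}) -> Prop) (v : 'I_n.+1 -> Rr) :=
  v ord0 < 0 /\
  forall m : 'X_{1..n.+1},
    ~ in_gen_ideal (fun g => exists F, J F /\ init_rel v F g) 'X_[m].

Definition eucl_closure (S : ('I_n.+1 -> Rr) -> Prop) (v : 'I_n.+1 -> Rr) :=
  forall eps : Rr, 0 < eps ->
    exists u, S u /\ forall i, `|v i - u i| < eps.

Definition Trop (J : (nat -> {mpoly R[n]}) -> Prop) : ('I_n.+1 -> Rr) -> Prop :=
  eucl_closure (Trop_open J).
End PowerSeries.

(* Main.v *)
Require Import Defs.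
From HB Require Import structures.
From mathcomp Require Import all_boot all_order all_algebra.
From mathcomp Require Import mpoly.
From mathcomp Require Import reals.
From mathcomp Require boolp.
From mathcomp Require Import zify ring lra.
Import Order.TTheory GRing.Theory Num.Theory.
Local Open Scope ring_scope.

(**
Both sides are governed by one condition: [f] in [I] has a coefficient at some
[m] whose weight [w . m - nu f_m] strictly exceeds all the other weights.

If the initial ideal over the residue field contains [x^m], such an [f] exists:
initial forms are homogeneous for the grading by [w . a] modulo the integers, so
in [x^m = sum_i g_i in(f_i)] only the terms of the right class matter, and after
rescaling by powers of [p] they lift to elements of [I] of the same weight whose
sum has initial form [x^m].  The same argument with the [v]-grading shows that a
monomial in the initial ideal of the preimage yields an element whose image
under [t |-> p] has a strictly dominant coefficient.

Conversely, expanding the coefficients of [p^N f / f_m] into [p]-adic digits in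
[R] gives a lift with initial form [t^N x^m], and this holds for every weight
near [(-1, w)]; this also disposes of the Euclidean closure.
*)

Set Implicit Arguments.
Unset Strict Implicit.
Unset Printing Implicit Defensive.

(** * Valuations and convergence *)

Definition upclosed (Q : int -> Prop) : Prop :=
  forall e e', e <= e' -> Q e -> Q e'.

Definition val_in (K : fieldType) (nu : K -> int) (Q : int -> Prop) (x : K) :=
  x = 0 \/ Q (nu x).

Lemma upclosed_ge (e : int) : upclosed (fun e' => e <= e').
Proof. by move=> a b ab /le_trans; apply. Qed.

Section Valuation.
Variables (K : fieldType) (nu : K -> int).
Hypothesis nuP : is_valuation nu.

Lemma valM x y : x != 0 -> y != 0 -> nu (x * y) = nu x + nu y.
Proof. by case: nuP => + _; apply. Qed.

Lemma val1 : nu 1 = 0.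
Proof. by have := valM (oner_neq0 K) (oner_neq0 K); rewrite mulr1; move: (nu 1) => a; lia. Qed.

Lemma valN x : nu (- x) = nu x.
Proof.
have [->|x0] := eqVneq x 0; first by rewrite oppr0.
have N1 : (-1 : K) != 0 by rewrite oppr_eq0 oner_eq0.
have := valM N1 N1; rewrite mulrNN mulr1 val1 => h.
by rewrite -mulN1r valM //; lia.
Qed.

Lemma valV x : x != 0 -> nu x^-1 = - nu x.
Proof.
move=> x0; have xV : x^-1 != 0 by rewrite invr_eq0.
by have := valM x0 xV; rewrite mulfV // val1; lia.
Qed.

Lemma valX x k : x != 0 -> nu (x ^+ k) = k%:Z * nu x.
Proof.
move=> x0; elim: k => [|k IH]; first by rewrite expr0 val1; lia.
by rewrite exprS valM ?expf_neq0 // IH; lia.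
Qed.

Lemma valXz x (e : int) : x != 0 -> nu (x ^ e) = e * nu x.
Proof.
move=> x0; case: e => k; first by rewrite -exprnP valX.
by rewrite NegzE -exprnN valV ?expf_neq0 // valX //; lia.
Qed.

Lemma val_inD Q x y : upclosed Q ->
  val_in nu Q x -> val_in nu Q y -> val_in nu Q (x + y).
Proof.
move=> uQ; have [->|x0] := eqVneq x 0; first by rewrite add0r.
have [->|y0] := eqVneq y 0; first by rewrite addr0.
have [->|xy0] := eqVneq (x + y) 0; first by left.
case=> [/eqP|Qx]; first by rewrite (negbTE x0).
case=> [/eqP|Qy]; first by rewrite (negbTE y0).
right; have [_ /(_ _ _ x0 y0 xy0) h] := nuP.
by apply: uQ h _; case: (leP (nu x) (nu y)).
Qed.

Lemma val_inN Q x : val_in nu Q x -> val_in nu Q (- x).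
Proof. by case=> [->|Qx]; [left; rewrite oppr0 | right; rewrite valN]. Qed.

Lemma val_inB Q x y : upclosed Q ->
  val_in nu Q x -> val_in nu Q y -> val_in nu Q (x - y).
Proof. by move=> uQ Qx Qy; apply: val_inD => //; apply: val_inN. Qed.

Lemma val_in_sum Q (J : Type) (r : seq J) (P : pred J) F : upclosed Q ->
  (forall i, P i -> val_in nu Q (F i)) -> val_in nu Q (\sum_(i <- r | P i) F i).
Proof.
move=> uQ QF; apply: big_ind => //; first by left.
by move=> x y; apply: val_inD.
Qed.

Lemma inOM c x (e : int) : inO nu c -> val_in nu (fun e' => e <= e') x ->
  val_in nu (fun e' => e <= e') (c * x).
Proof.
have [->|c0] := eqVneq c 0; first by left; rewrite mul0r.
have [->|x0] := eqVneq x 0; first by left; rewrite mulr0.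
case=> [/eqP|cO]; first by rewrite (negbTE c0).
case=> [/eqP|xe]; first by rewrite (negbTE x0).
by right; rewrite valM //; lia.
Qed.

Lemma inO_mulXz x y (e : int) : y != 0 -> nu y = 1 ->
  inO nu (x * y ^ (- e)) <-> val_in nu (fun e' => e <= e') x.
Proof.
move=> y0 y1; have yX k : y ^ k != 0 by rewrite expfz_neq0.
rewrite /inO /val_in; have [->|x0] := eqVneq x 0.
  by rewrite mul0r; split=> _; left.
rewrite valM // valXz // y1; split=> -[/eqP|h].
- by rewrite mulf_eq0 (negbTE x0) (negbTE (yX _)).
- by right; lia.
- by rewrite (negbTE x0).
- by right; lia.
Qed.

Lemma closeNP N x y : closeN nu N x y <-> val_in nu (fun e => N%:Z <= e) (x - y).
Proof.
by split=> -[h|h]; [left; rewrite h subrr | right | left; apply/subr0_eq | right].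
Qed.

(** [Q N%:Z] puts every element of valuation at least [N] into the subgroup cut out by [Q], so a
    late term and the limit differ by an element of that subgroup. *)
Lemma converges_val_in Q (N : nat) s L : upclosed Q -> Q N%:Z ->
  converges nu s L -> (exists M, forall m, (M <= m)%N -> val_in nu Q (s m)) ->
  val_in nu Q L.
Proof.
move=> uQ QN /(_ N)[M sL] [M' sQ].
have /closeNP h := sL _ (leq_maxl M M').
rewrite -(subKr (s (maxn M M')) L); apply: val_inB => //.
  by apply: sQ; apply: leq_maxr.
by case: h => [->|h]; [left | right; apply: uQ h QN].
Qed.

Lemma converges_eventually s s' L :
  (exists M, forall m, (M <= m)%N -> s m = s' m) ->
  converges nu s L -> converges nu s' L.
Proof.
move=> [M ss'] sL N; have [M' h] := sL N; exists (maxn M M') => m.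
by rewrite geq_max => /andP[/ss' <- /h].
Qed.

Lemma converges_cst c : converges nu (fun=> c) c.
Proof. by move=> N; exists 0 => m _; left. Qed.

Lemma convergesD s s' L L' : converges nu s L -> converges nu s' L' ->
  converges nu (fun m => s m + s' m) (L + L').
Proof.
move=> sL sL' N; have [M h] := sL N; have [M' h'] := sL' N.
exists (maxn M M') => m; rewrite geq_max => /andP[/h /closeNP a /h' /closeNP b].
apply/closeNP; rewrite opprD addrACA; apply: val_inD => //.
exact: upclosed_ge.
Qed.

(** Multiplying a series by [t ^ k] delays its partial sums by [k] steps; this is used for the image
    of a monomial multiple under [t |-> p]. *)
Lemma converges_scale_shift c k s L : inO nu c -> converges nu s L ->
  converges nu (fun m => c * s (m - k)%N) (c * L).
Proof.
move=> cO sL N; have [M h] := sL N; exists (M + k)%N => m Mm.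
apply/closeNP; rewrite -mulrBr; apply: inOM => //; apply/closeNP/h; lia.
Qed.

End Valuation.

(** * Weights of exponents and their continuity *)

Section MultinomialWeights.
Variables (Rr : realType).

Lemma wdotD n (w : 'I_n -> Rr) a b : wdot w (a + b)%MM = wdot w a + wdot w b.
Proof.
rewrite /wdot -big_split; apply: eq_bigr => i _ /=.
by rewrite mnmDE natrD mulrDr.
Qed.

Lemma wdotB n (w : 'I_n -> Rr) a m : (a <= m)%MM ->
  wdot w (m - a)%MM = wdot w m - wdot w a.
Proof. by move=> am; rewrite -{2}(submK am) wdotD addrK. Qed.

Lemma wdotS n (v : 'I_n.+1 -> Rr) M :
  wdot v M = v ord0 * (M ord0)%:R + wdot (fun i => v (lift ord0 i)) (mtail M).
Proof.
rewrite /wdot big_ord_recl; congr (_ + _); apply: eq_bigr => i _.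
by rewrite mnmE.
Qed.

Definition mcons n (b : nat) (a : 'X_{1..n}) : 'X_{1..n.+1} :=
  [multinom oapp a b (unlift ord0 i) | i < n.+1].

Lemma mcons0 n b (a : 'X_{1..n}) : mcons b a ord0 = b.
Proof. by rewrite mnmE unlift_none. Qed.

Lemma mtail_mcons n b (a : 'X_{1..n}) : mtail (mcons b a) = a.
Proof. by apply/mnmP => i; rewrite !mnmE liftK. Qed.

Lemma mcons_mtail n (M : 'X_{1..n.+1}) : mcons (M ord0) (mtail M) = M.
Proof.
by apply/mnmP => i; rewrite mnmE; case: unliftP => [j|] -> //=; rewrite mnmE.
Qed.

Lemma lem_mtail n (a M : 'X_{1..n.+1}) :
  (a <= M)%MM = (a ord0 <= M ord0)%N && (mtail a <= mtail M)%MM.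
Proof.
apply/mnm_lepP/andP => [h|[h0 /mnm_lepP h] i].
  by split=> //; apply/mnm_lepP => i; rewrite !mnmE.
by case: (unliftP ord0 i) => [j|] -> //; have := h j; rewrite !mnmE.
Qed.

Lemma mtailB n (M a : 'X_{1..n.+1}) : mtail (M - a)%MM = (mtail M - mtail a)%MM.
Proof. by apply/mnmP => i; rewrite !mnmE. Qed.

Lemma wdot_dist n (u v : 'I_n -> Rr) M eps : (forall i, `|v i - u i| < eps) ->
  `|wdot v M - wdot u M| <= eps * (mdeg M)%:R.
Proof.
move=> uv; rewrite /wdot -sumrB mdegE natr_sum mulr_sumr.
apply: le_trans (ler_norm_sum _ _ _) _; apply: ler_sum => i _.
by rewrite -mulrBl normrM normr_nat ler_wpM2r ?ler0n // ltW.
Qed.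

Lemma wdot_lt_open n (v : 'I_n -> Rr) M M' : wdot v M < wdot v M' ->
  exists2 eps, 0 < eps &
    forall u, (forall i, `|v i - u i| < eps) -> wdot u M < wdot u M'.
Proof.
(* The summand 1 leaves a margin: both weights together move by at most [eps] times the two degrees,
   which is the gap minus [eps]. *)
move=> MM'; pose s : Rr := (mdeg M)%:R + (mdeg M')%:R + 1.
have s0 : 0 < s by rewrite ltr_wpDl ?addr_ge0 ?ler0n.
pose eps := (wdot v M' - wdot v M) / s.
have e0 : 0 < eps by rewrite divr_gt0 // subr_gt0.
exists eps => // u uv; have := wdot_dist M uv; have := wdot_dist M' uv.
have : eps * s = wdot v M' - wdot v M by rewrite divfK ?gt_eqF.
rewrite /s !mulrDr mulr1 !ler_norml => h /andP[h1 h2] /andP[h3 h4]; lra.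
Qed.

Lemma wdot_lt_open_all n (v : 'I_n -> Rr) (r : seq 'X_{1..n}) M' :
  (forall M, M \in r -> wdot v M < wdot v M') ->
  exists2 eps, 0 < eps & forall u, (forall i, `|v i - u i| < eps) ->
    forall M, M \in r -> wdot u M < wdot u M'.
Proof.
elim: r => [|M r IH] h; first by exists 1.
have [e1 e10 h1] := wdot_lt_open (h _ (mem_head _ _)).
have [|e2 e20 h2] := IH; first by move=> M2 M2r; apply: h; rewrite inE M2r orbT.
exists (Num.min e1 e2) => [|u uv M2]; first by rewrite lt_min e10.
rewrite inE => /orP[/eqP ->|].
  by apply: h1 => i; apply: lt_le_trans (uv i) _; rewrite ge_min lexx.
by apply: h2 => i; apply: lt_le_trans (uv i) _; rewrite ge_min lexx orbT.
Qed.

End MultinomialWeights.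

(** * Term-by-term computations with polynomials *)

Lemma mcoeff_monM (R : comNzRingType) n (c : R) a (q : {mpoly R[n]}) m :
  (c *: 'X_[a] * q)@_m = if (a <= m)%MM then c * q@_(m - a) else 0.
Proof.
rewrite -scalerAl mcoeffZ; case: ifPn => [am|nam].
  by rewrite -{1}(submK am) addmC [_ * q]mulrC mcoeffMX.
suff -> : ('X_[a] * q)@_m = 0 by rewrite mulr0.
apply/eqP; rewrite mcoeff_eq0; apply: contra nam => /msuppM_le.
case/allpairsP => -[m1 m2] /= []; rewrite msuppX inE => /eqP -> _ ->.
exact: lem_addr.
Qed.

(** Expanding the multipliers into terms leaves only multiples by single terms, which respect the
    gradings used below. *)
Lemma gen_ideal_mon_ind (R : comNzRingType) n (S P : {mpoly R[n]} -> Prop) :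
  P 0 -> (forall x y, P x -> P y -> P (x + y)) ->
  (forall c a s, S s -> P (c *: 'X_[a] * s)) ->
  forall x, in_gen_ideal S x -> P x.
Proof.
move=> P0 PD PS x [k [g [s [Ss ->]]]]; apply: big_ind => // i _.
rewrite (mpolyE (g i)) mulr_suml; apply: big_ind => // a _; exact: PS.
Qed.

Lemma mcoeff_sum_mon (R : comNzRingType) n (r : seq 'X_{1..n}) (P : pred 'X_{1..n})
    (c : 'X_{1..n} -> R) m : uniq r ->
  (\sum_(a <- r | P a) c a *: 'X_[a])@_m =
    if (m \in r) && P m then c m else 0.
Proof.
move=> ur; rewrite raddf_sum big_mkcond /=.
have E a : a != m -> (if P a then (c a *: 'X_[a])@_m else 0) = 0.
  by move=> am; case: ifP => // _; rewrite mcoeffZ mcoeffX (negbTE am) mulr0.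
case: ifPn => [/andP[mr Pm]|nm].
  rewrite (bigD1_seq m) //= big1 => [|a am]; last exact: E.
  by rewrite addr0 Pm mcoeffZ mcoeffX eqxx mulr1.
rewrite big1_seq // => a /= ar; case: (eqVneq a m) ar => [->|/E //].
by rewrite -if_neg; move: nm; rewrite negb_and => /orP[/negbTE->|->].
Qed.

Lemma seq_argmax (T : eqType) (R : realDomainType) (phi : T -> R) (s : seq T) :
  s != [::] -> exists2 x, x \in s & forall y, y \in s -> phi y <= phi x.
Proof.
elim: s => // x [|x' s] IH _.
  by exists x; rewrite ?mem_head // => y; rewrite inE => /eqP ->.
have [//|z zs zP] := IH; have [xz|zx] := leP (phi x) (phi z).
  by exists z => [|y]; rewrite inE ?zs ?orbT // => /orP[/eqP ->|/zP].
exists x => [|y]; first exact: mem_head.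
by rewrite inE => /orP[/eqP ->|/zP yz] //; apply: le_trans yz (ltW zx).
Qed.

(** * Initial forms over the residue field *)

Definition dominates (Rr : realType) (K : fieldType) (nu : K -> int) n
    (w : 'I_n -> Rr) (f : {mpoly K[n]}) (m : 'X_{1..n}) : Prop :=
  f@_m != 0 /\
  forall m', f@_m' != 0 -> m' != m -> valw nu w f m' < valw nu w f m.

Section InitialForms.
Variables (Rr : realType) (K : fieldType) (nu : K -> int) (kk : fieldType)
  (res : K -> kk) (p : K) (n : nat) (w : 'I_n -> Rr).
Hypotheses (nuP : is_valuation nu) (p0 : p != 0) (nup : nu p = 1)
  (resP : residue_map nu res).

Local Notation init := (in_nu nu res p w).

Let pX (e : int) : p ^ e != 0. Proof. by rewrite expfz_neq0. Qed.

Let nuX (e : int) : nu (p ^ e) = e.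
Proof. by rewrite (valXz nuP) // nup mulr1. Qed.

Lemma res0 : res 0 = 0.
Proof. by case: resP => _ _ _ /(_ 0) h _; apply/h; left. Qed.

Lemma res_unit_neq0 x : x != 0 -> nu x = 0 -> res x != 0.
Proof.
case: resP => _ _ _ h _ x0 nx; apply/eqP => /h; case; first by right; rewrite nx.
  by move/eqP; rewrite (negbTE x0).
by rewrite nx.
Qed.

Lemma res_pos x : 0 < nu x -> res x = 0.
Proof. by case: resP => _ _ _ h _ x0; apply/h; [right; apply: ltW | right]. Qed.

Lemma mcoeff_in_nu f m : (init f)@_m =
  if (m \in msupp f) && all (fun m' => valw nu w f m' <= valw nu w f m) (msupp f)
  then res (f@_m * p ^ (- nu f@_m)) else 0.
Proof. by rewrite /in_nu mcoeff_sum_mon ?msupp_uniq. Qed.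

Lemma mcoeff_in_nu_max f m0 m : m0 \in msupp f ->
    (forall m', m' \in msupp f -> valw nu w f m' <= valw nu w f m0) ->
  (init f)@_m = if (m \in msupp f) && (valw nu w f m == valw nu w f m0)
                then res (f@_m * p ^ (- nu f@_m)) else 0.
Proof.
move=> m0f m0P; rewrite mcoeff_in_nu; case: (boolP (m \in _)) => //= mf.
congr (if _ then _ else _); apply/allP/eqP => [h|-> //].
by apply/le_anti; rewrite m0P // h.
Qed.

Lemma dominates_in_nu f m : dominates nu w f m ->
  exists2 c, c != 0 & init f = c *: 'X_[m].
Proof.
move=> [fm fP]; exists (res (f@_m * p ^ (- nu f@_m))).
  apply: res_unit_neq0; first by rewrite mulf_neq0.
  by rewrite (valM nuP) // nuX; lia.
have m_max m' : m' \in msupp f -> valw nu w f m' <= valw nu w f m.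
  by rewrite mcoeff_msupp => m'f; have [->|/(fP _ m'f)/ltW] := eqVneq m' m.
apply/mpolyP => a; rewrite (mcoeff_in_nu_max _ _ m_max) ?mcoeff_msupp //.
rewrite mcoeffZ mcoeffX; have [<-|am] := eqVneq m a.
  by rewrite fm eqxx mulr1.
rewrite mulr0; case: ifP => // /andP[fa /eqP va].
by have := fP _ fa; rewrite va ltxx eq_sym am => /(_ isT).
Qed.

Variables (I : {mpoly K[n]} -> Prop) (IP : is_ideal I).

(** Leading terms may cancel in a sum, so being an initial form is not additive. This relaxation is:
    [h] has weights at most [W], possibly all smaller, and is compared with [q] only where weight
    [W] is attainable, that is where [wdot w a - W] is an integer. *)
Definition reduces_to (W : Rr) (q : {mpoly kk[n]}) : Prop :=
  exists h, [/\ I h,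
    (forall a, val_in nu (fun e => wdot w a - W <= e%:~R) h@_a)
    & forall a (E : int), wdot w a - W = E%:~R -> res (h@_a * p ^ (- E)) = q@_a].

Lemma upclosed_real_ge (r : Rr) : upclosed (fun e => r <= e%:~R).
Proof. by move=> e e' ee' h; apply: le_trans h _; rewrite ler_int. Qed.

Lemma reduces_to0 W : reduces_to W 0.
Proof.
case: IP => I0 _ _; exists 0; split=> // [a|a E _]; rewrite mcoeff0 ?mul0r.
  by left.
by rewrite mcoeff0 res0.
Qed.

Lemma val_in_inO (x : K) r (E : int) : r = E%:~R ->
  val_in nu (fun e => r <= e%:~R :> Rr) x -> inO nu (x * p ^ (- E)).
Proof.
move=> -> xE; apply/(inO_mulXz nuP) => //.
by case: xE => [->|h]; [left | right; move: h; rewrite ler_int].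
Qed.

Lemma reduces_toD W q q' :
  reduces_to W q -> reduces_to W q' -> reduces_to W (q + q').
Proof.
move=> [h [Ih hW hq]] [h' [Ih' hW' hq']]; exists (h + h'); split.
- by case: IP => _ + _; apply.
- move=> a; rewrite mcoeffD; apply: val_inD => //; exact: upclosed_real_ge.
move=> a E aE; rewrite !mcoeffD mulrDl; case: resP => _ resD _ _ _.
by rewrite resD ?hq ?hq' //; apply: val_in_inO aE _.
Qed.

(* Initial forms are homogeneous for the grading of exponents by
   [wdot w a] modulo the integers, so a term of [c *: 'X_[a] * init f] either
   does not meet the level [W], or reaches it after multiplication by a power
   of [p]. *)
Lemma reduces_to_mon W c a f : I f -> reduces_to W (c *: 'X_[a] * init f).
Proof.
move=> If; have [f0|f0] := eqVneq f 0.
  suff -> : init f = 0 by rewrite mulr0; apply: reduces_to0.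
  by rewrite /in_nu f0 -mpolyC0 msupp0 big_nil.
have [m0 m0f m0P] : exists2 m0, m0 \in msupp f &
    forall m, m \in msupp f -> valw nu w f m <= valw nu w f m0.
  by apply: seq_argmax; rewrite msupp_eq0.
have initE := mcoeff_in_nu_max _ m0f m0P.
set W0 := valw nu w f m0 in m0P initE.
case: (boolp.EM (exists e : int, wdot w a + W0 - W = e%:~R)) => [[e eE]|ne];
    last first.
  (* A nonzero coefficient of the product at an exponent [b] of integral level would make
     [wdot w a + W0 - W] an integer, so the zero polynomial is a valid witness. *)
  exists 0; split=> [|b|b E bE]; rewrite ?mcoeff0 ?mul0r ?res0.
  - by case: IP.
  - by left.
  rewrite mcoeff_monM; case: ifPn => // ab; rewrite initE.
  case: ifPn => [/andP[_ /eqP]|]; last by rewrite mulr0.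
  rewrite {1}/valw wdotB // => bW; case: ne; exists (E - nu f@_(b - a)).
  by rewrite intrB -bE -bW; ring.
have [_ _ resM _ /(_ c)[u [uO resu]]] := resP.
exists ((u * p ^ e) *: 'X_[a] * f); split=> [|b|b E bE].
- by case: IP => _ _; apply.
- rewrite mcoeff_monM; case: ifPn => [ab|]; last by left.
  have [->|fb] := eqVneq f@_(b - a) 0; first by left; rewrite mulr0.
  have [->|u0] := eqVneq u 0; first by left; rewrite !mul0r.
  right; rewrite !(valM nuP) ?mulf_neq0 // nuX !intrD.
  have := m0P (b - a)%MM; rewrite mcoeff_msupp fb /valw wdotB // => /(_ isT).
  case: uO => [/eqP|]; first by rewrite (negbTE u0).
  by rewrite -(ler_int Rr); lra.
rewrite !mcoeff_monM; case: ifPn => [ab|]; last by rewrite mul0r res0.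
have [fb|fb] := eqVneq f@_(b - a) 0.
  by rewrite initE fb mulr0 mul0r res0 mcoeff_msupp fb eqxx mulr0.
have -> : u * p ^ e * f@_(b - a) * p ^ (- E) = u * (f@_(b - a) * p ^ (e - E)).
  by rewrite expfzDr //; ring.
have nux : nu (f@_(b - a) * p ^ (e - E)) = nu f@_(b - a) + (e - E).
  by rewrite (valM nuP) // nuX.
have le : valw nu w f (b - a)%MM <= W0 by apply: m0P; rewrite mcoeff_msupp.
(* The valuation of the normalised coefficient is the defect of its weight from the maximum [W0], so
   its residue survives exactly at the terms of the initial form. *)
have bW : W0 - valw nu w f (b - a)%MM = (nu f@_(b - a) + (e - E))%:~R.
  by rewrite !intrD mulrNz -eE -bE /valw wdotB //; ring.
have nu_ge0 : 0 <= nu (f@_(b - a) * p ^ (e - E)).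
  by rewrite nux -(ler_int Rr) -bW subr_ge0.
rewrite resM //; last by right.
rewrite resu initE mcoeff_msupp fb /=; congr (_ * _); case: ifPn => [/eqP|] vW.
  move: bW; rewrite vW subrr => /esym/eqP; rewrite intr_eq0 => /eqP h.
  by congr (res (_ * p ^ _)); lia.
apply: res_pos; rewrite nux -(ltr_int Rr) -bW subr_gt0.
by rewrite lt_neqAle vW.
Qed.

(** Take [h] reducing to ['X_[m]] at level [wdot w m]. Residue 1 at [m] forces the weight there to
    reach the level, and every other weight stays strictly below it. *)
Lemma in_nu_mon_dominates m :
  in_gen_ideal (fun g => exists f, I f /\ g = init f) 'X_[m] ->
  exists2 f, I f & dominates nu w f m.
Proof.
move=> Xm; have : reduces_to (wdot w m) 'X_[m].
  apply: gen_ideal_mon_ind Xm; first exact: reduces_to0.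
    exact: reduces_toD.
  by move=> c a _ [f [If ->]]; apply: reduces_to_mon.
case=> h [Ih hW hX]; exists h => //.
have := hX m 0; rewrite subrr mcoeffX eqxx oppr0 expr0z mulr1 => /(_ erefl) hm.
have hm0 : h@_m != 0.
  by apply/eqP => h0; move: hm; rewrite h0 res0 => /esym/eqP; rewrite oner_eq0.
have num : nu h@_m <= 0.
  rewrite leNgt; apply/negP => /res_pos; rewrite hm => /eqP.
  by rewrite oner_eq0.
split=> // a ha am; apply: (@lt_le_trans _ _ (wdot w m)); last first.
  by rewrite /valw lerBrDr gerDl lerz0.
case: (hW a) => [/eqP|]; first by rewrite (negbTE ha).
(* In the equality case the normalised coefficient at [a] is a unit, yet its residue is the
   coefficient 0 of ['X_[m]] at [a]. *)
rewrite le_eqVlt => /orP[/eqP aE|]; last by rewrite /valw; lra.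
have := hX a _ aE; rewrite mcoeffX eq_sym (negbTE am) => /eqP.
rewrite (negbTE (res_unit_neq0 _ _)) ?mulf_neq0 //.
by rewrite (valM nuP) // nuX; lia.
Qed.

Lemma dominates_not_Trop_nu f m : I f -> dominates nu w f m ->
  ~ Trop_nu nu res p I w.
Proof.
move=> If /dominates_in_nu[c c0 fX] /(_ m); apply.
exists 1%N, (fun=> (c^-1)%:MP), (fun=> init f); split; first by move=> _; exists f.
by rewrite big_ord1 fX mul_mpolyC scalerA mulVf // scale1r.
Qed.

End InitialForms.

(** * The preimage under [t |-> p] as an ideal of coefficient sequences *)

Section PreimageIdeal.
Variables (Rr : realType) (K : fieldType) (nu : K -> int) (R : comNzRingType)
  (iota : {rmorphism R -> K}) (p : R) (n : nat) (I : {mpoly K[n]} -> Prop).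
Hypotheses (nuP : is_valuation nu) (p0 : iota p != 0) (nup : nu (iota p) = 1)
  (iotaO : forall r, inO nu (iota r)) (IP : is_ideal I).

Local Notation J := (preimage nu iota p I).

Let nuX k : nu (iota p ^+ k) = k%:Z.
Proof. by rewrite (valX nuP) // nup mulr1. Qed.

Lemma val_in_digit r b Q : upclosed Q -> (r != 0 -> Q b%:Z) ->
  val_in nu Q (iota r * iota p ^+ b).
Proof.
move=> uQ Qb; have [->|r0] := eqVneq (iota r) 0; first by left; rewrite mul0r.
right; rewrite (valM nuP) ?expf_neq0 // nuX.
case: (iotaO r) => [/eqP|r1]; first by rewrite (negbTE r0).
apply: uQ (Qb _); first by lia.
by apply: contra_neq r0 => ->; rewrite rmorph0.
Qed.

Lemma preimage0 : J (fun=> 0).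
Proof.
split; first by exists 0%N => b; rewrite msize0.
exists 0; split; last by case: IP.
move=> a; apply: converges_eventually (converges_cst _ _); exists 0%N => m _.
by rewrite mcoeff0 big1 // => b _; rewrite mcoeff0 rmorph0 mul0r.
Qed.

Lemma preimageD F G : J F -> J G -> J (fun b => F b + G b).
Proof.
move=> [[d Fd] [f [piF If]]] [[d' Gd'] [g [piG Ig]]]; split.
  exists (maxn d d') => b; apply: leq_trans (msizeD_le _ _) _.
  by rewrite geq_max !leq_max Fd Gd' orbT.
exists (f + g); split; last by case: IP => _ + _; apply.
move=> a; rewrite mcoeffD.
apply: converges_eventually (convergesD nuP (piF a) (piG a)); exists 0%N => m _.
rewrite -big_split; apply: eq_bigr => b _ /=.
by rewrite mcoeffD rmorphD mulrDl.
Qed.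

(** Multiplication by a term in [t] and [x]: the power of [t] acts as a shift of the coefficient
    sequence. *)
Definition mon_mul (c : R) (a : 'X_{1..n.+1}) (F : nat -> {mpoly R[n]}) b :=
  if (a ord0 <= b)%N then c *: 'X_[mtail a] * F (b - a ord0)%N else 0.

Lemma coef_tx_mon_mul c a F M : coef_tx (mon_mul c a F) M =
  if (a <= M)%MM then c * coef_tx F (M - a) else 0.
Proof.
rewrite /coef_tx /mon_mul lem_mtail mtailB mnmBE; case: ifP => //= _.
  exact: mcoeff_monM.
by rewrite mcoeff0.
Qed.

Lemma preimage_mon_mul c a F : J F -> J (mon_mul c a F).
Proof.
move=> [[d Fd] [g [piF Ig]]]; split.
  exists (msize (c *: 'X_[mtail a] : {mpoly R[n]}) + d).+1 => b.
  rewrite /mon_mul; case: ifP => _; last by rewrite msize0.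
  by apply: leq_trans (msizeM_le _ _) _; rewrite ltnS leq_add2l.
set k := a ord0; exists ((iota c * iota p ^+ k) *: 'X_[mtail a] * g).
split; last by case: IP => _ _; apply.
move=> b; rewrite mcoeff_monM; case: ifPn => [ab|nab].
  have cO : inO nu (iota c * iota p ^+ k).
    apply: (inOM nuP) => //; right; rewrite nuX; lia.
  apply: converges_eventually (converges_scale_shift nuP k cO (piF _)).
  exists k => m km; have [j ->] : exists j, m = (k + j)%N.
    by exists (m - k)%N; rewrite subnKC.
  (* The first [k] summands of the shifted series vanish; the others carry a common factor
     [iota p ^+ k]. *)
  rewrite addKn big_split_ord /= [X in _ = X + _]big1 => [|b' _]; last first.
    by rewrite /mon_mul leqNgt ltn_ord /= mcoeff0 rmorph0 mul0r.
  rewrite add0r mulr_sumr; apply: eq_bigr => b' _.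
  by rewrite /mon_mul leq_addr addKn mcoeff_monM ab rmorphM exprD /=; ring.
apply: converges_eventually (converges_cst _ _); exists 0%N => m _.
rewrite big1 // => j _; rewrite /mon_mul; case: ifP => _.
  by rewrite mcoeff_monM (negbTE nab) rmorph0 mul0r.
by rewrite mcoeff0 rmorph0 mul0r.
Qed.

(** * From monomials in the initial ideal of the preimage to dominant coefficients *)

Section Level.
Variable v : 'I_n.+1 -> Rr.

(** The counterpart of [reduces_to] for the [v]-grading. Here [t] is a variable, so no rescaling
    occurs and coefficients are compared directly; again [G] may have no term at level [V]. *)
Definition tops_at (V : Rr) (q : {mpoly R[n.+1]}) : Prop :=
  exists G, [/\ J G, (forall M, coef_tx G M != 0 -> wdot v M <= V)
    & forall M, wdot v M = V -> coef_tx G M = q@_M].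

Lemma tops_at0 V : tops_at V 0.
Proof.
exists (fun=> 0); split; first exact: preimage0.
  by move=> M; rewrite /coef_tx mcoeff0 eqxx.
by move=> M _; rewrite /coef_tx !mcoeff0.
Qed.

Lemma tops_atD V q q' : tops_at V q -> tops_at V q' -> tops_at V (q + q').
Proof.
move=> [F [JF FV Fq]] [G [JG GV Gq]]; exists (fun b => F b + G b).
have E M : coef_tx (fun b => F b + G b) M = coef_tx F M + coef_tx G M.
  by rewrite /coef_tx mcoeffD.
split; first exact: preimageD; move=> M; rewrite E; last first.
  by move=> MV; rewrite mcoeffD Fq ?Gq.
have [->|/FV //] := eqVneq (coef_tx F M) 0; rewrite add0r; exact: GV.
Qed.

Lemma tops_at_mon V c a F g : J F -> init_rel v F g ->
  tops_at V (c *: 'X_[a] * g).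
Proof.
move=> JF Fg; case: (boolp.EM (exists M, is_max_term v F M)) => [[M0 M0P]|noM];
    last first.
  (* The sign of [v] on [t] is not fixed yet, so a maximal term may fail to exist; [init_rel] then
     makes [g] zero. *)
  suff -> : g = 0 by rewrite mulr0; apply: tops_at0.
  apply/mpolyP => M; rewrite mcoeff0; apply: (proj2 (Fg M)) => MP.
  by apply: noM; exists M.
have g_eq M : g@_M != 0 -> wdot v M = wdot v M0.
  move=> gM; case: (boolp.EM (is_max_term v F M)) => [[FM MP]|/(proj2 (Fg M)) g0].
    case: M0P => FM0 M0P; apply/le_anti.
    by rewrite M0P // MP.
  by rewrite g0 eqxx in gM.
(* The product is homogeneous of degree [wdot v a + wdot v M0]; off the level [V] it contributes
   nothing. *)
have [aV|naV] := eqVneq (wdot v a + wdot v M0) V; last first.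
  exists (fun=> 0); split; first exact: preimage0.
    by move=> M; rewrite /coef_tx mcoeff0 eqxx.
  move=> M MV; rewrite /coef_tx mcoeff0 mcoeff_monM; case: ifPn => // aM.
  have [->|/g_eq] := eqVneq g@_(M - a) 0; first by rewrite mulr0.
  rewrite wdotB // => h; case/eqP: naV; rewrite -h -MV; ring.
exists (mon_mul c a F); split; first exact: preimage_mon_mul.
  move=> M; rewrite coef_tx_mon_mul; case: ifPn; last by rewrite eqxx.
  move=> aM cF; have /(proj2 M0P) : coef_tx F (M - a) != 0.
    by apply: contra_neq cF => ->; rewrite mulr0.
  by rewrite wdotB // -aV; lra.
move=> M MV; rewrite coef_tx_mon_mul mcoeff_monM; case: ifPn => // aM.
congr (_ * _); have dM : wdot v (M - a)%MM = wdot v M0.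
  by rewrite wdotB // MV -aV; ring.
case: (boolp.EM (is_max_term v F (M - a))) => [/(proj1 (Fg _)) //|nmax].
rewrite (proj2 (Fg _)) //; apply/eqP; apply: contra_notT nmax => h; split=> //.
by move=> M' /(proj2 M0P); rewrite dM.
Qed.

Hypothesis v0 : v ord0 = -1.

Local Notation w := (fun i => v (lift ord0 i)).

Lemma wdot_mcons b a : wdot v (mcons b a) = wdot w a - b%:R.
Proof. by rewrite wdotS mcons0 mtail_mcons v0 mulN1r addrC. Qed.

(** Some [G] in the preimage has [t ^ k x ^ m] as its only term at the top level. Hence [f@_m] is
    [p ^ k] plus higher valuation, while over any other [x ^ a] all digits sit strictly below the
    level, a strict bound that passes to the limit. *)
Lemma init_mon_dominates M0 :
  in_gen_ideal (fun g => exists F, J F /\ init_rel v F g) 'X_[M0] ->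
  exists2 f, I f & dominates nu w f (mtail M0).
Proof.
move=> XM; have : tops_at (wdot v M0) 'X_[M0].
  apply: gen_ideal_mon_ind XM; first exact: tops_at0.
    exact: tops_atD.
  by move=> c a g [F [JF Fg]]; apply: tops_at_mon Fg.
rewrite -(mcons_mtail M0) mtail_mcons wdot_mcons.
set k := M0 ord0; set m := mtail M0.
case=> G [[_ [f [piG If]]] GV GX]; exists f => //.
have GE b a : coef_tx G (mcons b a) = (G b)@_a.
  by rewrite /coef_tx mcons0 mtail_mcons.
have le b a : (G b)@_a != 0 -> wdot w a - b%:R <= wdot w m - k%:R.
  by rewrite -GE => /GV; rewrite wdot_mcons.
have top b a : wdot w a - b%:R = wdot w m - k%:R ->
    (G b)@_a = (mcons k m == mcons b a)%:R.
  by rewrite -GE -mcoeffX => h; apply: GX; rewrite wdot_mcons.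
have coef_m : val_in nu (fun e => k%:Z < e) (f@_m - iota p ^+ k).
  have up : upclosed (fun e => k%:Z < e) by move=> e e' ee' ke; lia.
  apply: (converges_val_in nuP (N := k.+1) up _
    (convergesD nuP (piG m) (converges_cst nu (- iota p ^+ k)))); first by lia.
  (* Partial sums with more than [k] terms contain [p ^ k], which cancels; the remaining nonzero
     digits have index above [k]. *)
  exists k.+1 => N kN; rewrite (bigD1 (Ordinal kN)) //= top // eqxx rmorph1 mul1r.
  rewrite addrAC subrr add0r; apply: val_in_sum => // b bk.
  apply: val_in_digit => // /le; rewrite lerD2l lerN2 ler_nat leq_eqVlt.
  by move: bk; rewrite -val_eqE /= eq_sym => /negbTE ->; lia.
have not_in : ~ val_in nu (fun e => k%:Z < e) f@_m.
  move=> fm; have : val_in nu (fun e => k%:Z < e) (iota p ^+ k).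
    rewrite -(subKr f@_m (_ ^+ k)); apply: val_inB => //.
    by move=> e e' ee' ke; lia.
  case=> [/eqP|]; first by rewrite expf_eq0 (negbTE p0) andbF.
  by rewrite nuX ltxx.
have fm0 : f@_m != 0 by apply/eqP => fm; apply: not_in; left.
have fm_le : nu f@_m <= k%:Z.
  by rewrite leNgt; apply/negP => fm; apply: not_in; right.
split=> // a fa am; apply: (@lt_le_trans _ _ (wdot w m - k%:R)); last first.
  by rewrite /valw lerD2l lerN2 -(ler_int Rr) in fm_le *.
pose r := wdot w a - (wdot w m - k%:R).
suff : val_in nu (fun e => r < e%:~R) f@_a.
  case=> [/eqP|]; first by rewrite (negbTE fa).
  by rewrite /valw /r; lra.
have up : upclosed (fun e => r < e%:~R).
  by move=> e e' ee' /lt_le_trans; apply; rewrite ler_int.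
(* Convergence is measured at integer precision, so an integer beyond the real threshold [r] is
   needed. *)
have rN : r < (Num.bound `|r|)%:Z%:~R.
  by apply: le_lt_trans (ler_norm r) (archi_boundP (normr_ge0 r)).
apply: (converges_val_in nuP up rN (piG a)); exists 0%N => N _.
apply: val_in_sum => // b _; apply: val_in_digit => // Gb.
have ne : wdot w a - b%:R != wdot w m - k%:R.
  apply/eqP => /top GbE; case/eqP: Gb; rewrite GbE.
  suff /negbTE -> : mcons k m != mcons b a by [].
  by apply: contra_neq am => h; rewrite -(mtail_mcons k m) h mtail_mcons.
have : wdot w a - b%:R < wdot w m - k%:R by rewrite lt_neqAle ne le.
by rewrite /r -pmulrn; lra.
Qed.

End Level.

(** * Digit expansions and lifts to power series *)

Hypothesis dense : dense_in_O nu iota.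

Lemma digits_exist x : inO nu x -> exists r : nat -> R,
  converges nu (fun N => \sum_(b < N) iota (r b) * iota p ^+ b) x /\
  forall b, r b != 0 -> x != 0 /\ nu x <= b%:Z.
Proof.
(* Density gives a digit congruent to [y] modulo [p]. Choosing exactly 0 when [p] divides [y] is
   what later excludes nonzero digits below [nu x]. *)
have /boolp.choice[dg dgP] : forall y, exists r, inO nu y ->
    val_in nu (fun e => 1 <= e) (y - iota r) /\
    (val_in nu (fun e => 1 <= e) y -> r = 0).
  move=> y.
  case: (boolp.EM (inO nu y)) => [yO|nyO]; last by exists 0.
  case: (boolp.EM (val_in nu (fun e => 1 <= e) y)) => [y1|ny1].
    by exists 0 => _; rewrite rmorph0 subr0.
  by have [r /closeNP rP] := dense yO 1%N; exists r => _; split.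
move=> xO; pose u k := iter k (fun y => (y - iota (dg y)) / iota p) x.
have uO k : inO nu (u k).
  elim: k => //= k /dgP[h _]; rewrite -exprN1.
  exact/(inO_mulXz nuP).
have xE k : x = \sum_(b < k) iota (dg (u b)) * iota p ^+ b + u k * iota p ^+ k.
  elim: k => [|k IH]; first by rewrite big_ord0 add0r mulr1.
  rewrite big_ord_recr /= {1}IH -addrA; congr (_ + _).
  by rewrite exprS mulrA divfK // mulrBl addrC subrK.
exists (fun b => dg (u b)); split.
  move=> N; exists N => m Nm; apply/closeNP; rewrite -opprB; apply: val_inN => //.
  rewrite {1}(xE m) addrAC subrr add0r; apply: inOM => //.
  by right; rewrite nuX; lia.
have dg0 k : val_in nu (fun e => k.+1%:Z <= e) x -> u k * iota p ^+ k = x ->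
    dg (u k) = 0.
  move=> xk ukE; apply: (proj2 (dgP _ (uO k))).
  have [->|uk0] := eqVneq (u k) 0; [by left | right].
  case: xk => [x0|]; last by rewrite -ukE (valM nuP) ?expf_neq0 // nuX; lia.
  move: ukE; rewrite x0 => /eqP.
  by rewrite mulf_eq0 expf_eq0 (negbTE p0) andbF (negbTE uk0).
(* As long as the power [p ^ k] divides [x], all earlier digits are 0 and the remainder is [x]
   divided by that power. *)
have u_small k : val_in nu (fun e => k%:Z <= e) x -> u k * iota p ^+ k = x.
  elim: k => [|k IH] xk; first by rewrite mulr1.
  have ukE : u k * iota p ^+ k = x.
    by apply: IH; case: xk => [|xk]; [left | right; lia].
  by rewrite /= -/(u k) dg0 // rmorph0 subr0 exprS mulrA divfK.
move=> b db; suff nx : ~ val_in nu (fun e => b.+1%:Z <= e) x.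
  split; first by apply/eqP => x0; apply: nx; left.
  by rewrite leNgt; apply/negP => bx; apply: nx; right; lia.
move=> xb; case/eqP: db; apply: dg0 => //; apply: u_small.
by case: xb => [|xb]; [left | right; lia].
Qed.

(* Scaling makes the dominant coefficient equal to [iota p ^+ N], which lifts
   to the single term [t ^ N], so that the lift has coefficient [1] there.  The
   higher digits of the other coefficients only lower the [u]-degree, as [u] is
   negative on [t]; hence finitely many open conditions on [u] suffice. *)
Lemma dominates_lift (v : 'I_n.+1 -> Rr) f m : v ord0 = -1 -> I f ->
  dominates nu (fun i => v (lift ord0 i)) f m ->
  exists F M eps, [/\ J F, 0 < eps & forall u, u ord0 < 0 ->
    (forall i, `|v i - u i| < eps) -> init_rel u F 'X_[M]].
Proof.
move=> v0 If [fm fdom].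
(* This [N] is large enough for every coefficient of the rescaled [g] to be integral. *)
pose N := \max_(a <- msupp f) `|nu f@_a - nu f@_m|%N.
pose g := (iota p ^+ N / f@_m) *: f.
have c0 : iota p ^+ N / f@_m != 0 by rewrite mulf_neq0 ?expf_neq0 ?invr_eq0.
have gE a : g@_a = iota p ^+ N / f@_m * f@_a by rewrite mcoeffZ.
have gm : g@_m = iota p ^+ N by rewrite gE divfK.
have nug a : f@_a != 0 -> nu g@_a = N%:Z - nu f@_m + nu f@_a.
  move=> fa; rewrite gE !(valM nuP) ?mulf_neq0 ?expf_neq0 ?invr_eq0 //.
  by rewrite nuX (valV nuP).
have gf a : (g@_a != 0) = (f@_a != 0) by rewrite gE mulf_eq0 (negbTE c0).
have gO a : inO nu g@_a.
  have [->|] := eqVneq g@_a 0; [by left | rewrite gf => fa; right].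
  have : (`|nu f@_a - nu f@_m| <= N)%N.
    by apply: (@leq_bigmax_seq _ _ _ (fun b => `|nu f@_b - nu f@_m|%N));
      rewrite ?mcoeff_msupp.
  by rewrite nug //; lia.
have Ig : I g by rewrite /g -mul_mpolyC; case: IP => _ _; apply.
have /boolp.choice[D DP] : forall a, exists r : nat -> R,
    [/\ converges nu (fun k => \sum_(b < k) iota (r b) * iota p ^+ b) g@_a,
      (forall b, r b != 0 -> g@_a != 0 /\ nu g@_a <= b%:Z)
      & a = m -> forall b, r b = (b == N)%:R].
  move=> a; have [->|am] := eqVneq a m; last first.
    by have [r [r1 r2]] := digits_exist (gO a); exists r; split=> // /eqP;
      rewrite (negbTE am).
  exists (fun b => (b == N)%:R); split=> // [|b].
    rewrite gm; apply: converges_eventually (converges_cst _ _).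
    exists N.+1 => k Nk; rewrite (bigD1 (Ordinal Nk)) //= eqxx rmorph1 mul1r.
    rewrite big1 ?addr0 // => b; rewrite -val_eqE /= => /negbTE ->.
    by rewrite rmorph0 mul0r.
  case: (b =P N) => [-> _|_]; last by rewrite eqxx.
  by rewrite gm nuX expf_neq0.
have Dne a b : D a b != 0 -> g@_a != 0 /\ nu g@_a <= b%:Z.
  by case: (DP a) => _ + _; apply.
have Dm b : D m b = (b == N)%:R by case: (DP m) => _ _; apply.
pose F b := \sum_(a <- msupp g) D a b *: 'X_[a].
have FE b a : (F b)@_a = D a b.
  rewrite /F mcoeff_sum_mon ?msupp_uniq // andbT mcoeff_msupp.
  by case: ifPn => // ga; apply/esym/eqP; apply: contraNT ga => /Dne[].
have JF : J F.
  split; last by exists g; split=> // a; have [h _ _] := DP a;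
    apply: converges_eventually h; exists 0%N => k _;
    apply: eq_bigr => b _; rewrite FE.
  exists (msize g) => b; rewrite (msizeE (F b)); apply/bigmax_leqP_seq => a aF _.
  apply: msize_mdeg_lt; move: aF; rewrite !mcoeff_msupp FE => /Dne.
  by case.
(* Nonzero digits over [x ^ a] start no earlier than [nu g@_a], so [low a] bounds the weights of all
   terms over [x ^ a]. *)
pose low a := mcons `|nu g@_a| a.
have [|eps eps0 epsP] := @wdot_lt_open_all _ _ v
    [seq low a | a <- msupp g & a != m] (mcons N m).
  move=> M /mapP[a]; rewrite mem_filter mcoeff_msupp gf => /andP[am fa] ->.
  rewrite !wdot_mcons // natr_absz ger0_norm; last first.
    by case: (gO a) => // /eqP; rewrite (negbTE (_ : g@_a != 0)) ?gf.
  have := fdom a fa am; rewrite /valw nug // !intrD mulrNz -pmulrn; lra.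
exists F, (mcons N m), eps; split=> // u u0 uv.
have coef_top : coef_tx F (mcons N m) = 1.
  by rewrite /coef_tx mcons0 mtail_mcons FE Dm eqxx.
have lt_top M : coef_tx F M != 0 -> M != mcons N m -> wdot u M < wdot u (mcons N m).
  rewrite -(mcons_mtail M) /coef_tx mcons0 mtail_mcons FE.
  set b := M ord0; set a := mtail M => Db Mne.
  have am : a != m.
    apply: contra_neq Mne => am; move: Db; rewrite am Dm.
    by case: (b =P N) => [->|] //; rewrite eqxx.
  have [ga nb] := Dne _ _ Db.
  apply: le_lt_trans (epsP u uv (low a) _); last first.
    by apply: map_f; rewrite mem_filter am mcoeff_msupp.
  rewrite !wdotS !mcons0 !mtail_mcons lerD2r ler_nM2l // ler_nat.
  by case: (gO a) => [/eqP|]; [rewrite (negbTE ga) | lia].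
move=> M; rewrite mcoeffX; have [<-|Mne] := eqVneq (mcons N m) M.
  split=> // -[]; split=> [|M']; first by rewrite coef_top oner_eq0.
  by have [->|h /lt_top/(_ h)/ltW] := eqVneq M' (mcons N m).
split=> // -[cM /(_ (mcons N m))]; rewrite coef_top oner_eq0 => /(_ isT).
by rewrite leNgt lt_top // eq_sym.
Qed.

End PreimageIdeal.

(** * The bijection *)

Theorem theorem2p12 (Rr : realType) (K : fieldType) (nu : K -> int)
  (kk : fieldType) (res : K -> kk) (R : comNzRingType)
  (iota : {rmorphism R -> K}) (p : R) (n : nat) (I : {mpoly K[n]} -> Prop) :
  is_valuation nu -> complete nu ->
  iota p != 0 -> nu (iota p) = 1 ->
  residue_map nu res ->
  injective iota -> (forall r, inO nu (iota r)) -> dense_in_O nu iota ->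
  noetherian R ->
  is_ideal I ->
  let A := fun v : 'I_n.+1 -> Rr =>
             Trop (preimage nu iota p I) v /\ v ord0 = -1 in
  let proj := fun (v : 'I_n.+1 -> Rr) (i : 'I_n) => v (lift ord0 i) in
  [/\ (forall v1 v2, A v1 -> A v2 -> proj v1 = proj v2 -> v1 = v2),
      (forall v, A v -> Trop_nu nu res (iota p) I (proj v))
    & (forall w, Trop_nu nu res (iota p) I w -> exists v, A v /\ proj v = w)].
Proof.
move=> nuP _ p0 nup resP _ iotaO dense _ IP A proj; split.
- move=> v1 v2 [_ v10] [_ v20] v12; apply: boolp.funext => i.
  case: (unliftP ord0 i) => [j|] ->; last by rewrite v10 v20.
  by have := congr1 (@^~ j) v12.
- move=> v [vT v0] m /(in_nu_mon_dominates nuP p0 nup resP IP)[f If fm].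
  have [F [M [eps [JF eps0 FP]]]] :=
    dominates_lift nuP p0 nup IP dense v0 If fm.
  (* A point of the closure has a nearby [u] in the open set, where the lift still has a monomial as
     initial form. *)
  have [u [[u0 uT] uv]] := vT eps eps0; apply: (uT M).
  exists 1%N, (fun=> 1), (fun=> 'X_[M]); split=> [_|].
    by exists F; split=> //; apply: FP.
  by rewrite big_ord1 mul1r.
move=> w wT; pose v (i : 'I_n.+1) : Rr := oapp w (-1) (unlift ord0 i).
have v0 : v ord0 = -1 by rewrite /v unlift_none.
have vw : proj v = w by apply: boolp.funext => i; rewrite /proj /v liftK.
(* Here [v] itself lies in the set whose closure is taken, so it approximates itself for every
   [eps]. *)
exists v; split=> //; split=> // eps eps0; exists v; split; last first.
  by move=> i; rewrite subrr normr0.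
split=> [|M]; first by rewrite v0 oppr_lt0 ltr01.
move=> /(init_mon_dominates nuP p0 nup iotaO IP v0)[f If fm].
by rewrite -vw in wT; apply: (dominates_not_Trop_nu nuP p0 nup resP If fm wT).
Qed.
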